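(* Let $\alpha>0$, $U_0>0$, $k>0$ be real, and let $U(x)=\frac{U_0}{\alpha^2}(\alpha^2-x^2)$ for $|x|\le\alpha$, $U(x)=0$ for $|x|\ge\alpha$. Let $\psi:\mathbb{R}\to\mathbb{C}$ be a continuously differentiable function which equals $e^{ikx}+re^{-ikx}$ for $x\le-\alpha$, equals a solution of $\psi''+[k^2-2U(x)]\psi=0$ on $[-\alpha,\alpha]$, and equals $te^{ikx}$ for $x\ge\alpha$, for some constants $r,t\in\mathbb{C}$. Then $\psi$ is twice continuously differentiable at $x=\pm\alpha$ and analytic at all other points. Moreover, the twice continuous differentiability holds for any continuous potential: if $U:\mathbb{R}\to\mathbb{R}$ is continuous and $\psi:\mathbb{R}\to\mathbb{C}$ is continuously differentiable and satisfies $\psi''+[k^2-2U(x)]\psi=0$ away from a finite set of matching points, then $\psi$ is twice continuously differentiable at each of these matching points.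
   Context: Units are $\hbar=m=1$; $\psi''+[k^2-2U]\psi=0$ is the Schrödinger equation for a particle with kinetic energy $k^2/2$. Wave functions are built piecewise by solving the equation on each interval between consecutive matching points and requiring $\psi$ and $\psi'$ to be continuous at the matching points. *)

(* Defs.v *)
From Stdlib Require Import Reals.
From Coquelicot Require Import Coquelicot.
Open Scope R_scope.

Definition Cexp (z : C) : C :=
  (exp (Re z) * (cos (Im z), sin (Im z)))%C.

(* Plane wave [e^{ikx}]. *)
Definition plane_wave (k x : R) : C := Cexp (Ci * RtoC k * RtoC x)%C.

(* [l] is the derivative at [x], relative to [D], of a complex-valued function
   of a real variable: ordinary [is_derive] at interior points of [D], a
   one-sided derivative at an endpoint of an interval.  Unfolds to [is_derive]
   with [locally x] replaced by its trace on [D]. *)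
Definition is_derive_within (D : R -> Prop) (f : R -> C) (x : R) (l : C) : Prop :=
  filterdiff (K := R_AbsRing) (U := R_NormedModule) (V := C_R_NormedModule)
    f (within D (locally x)) (fun h => scal h l).

Definition solves_schrodinger_on
    (k : R) (U : R -> R) (D : R -> Prop) (psi : R -> C) : Prop :=
  exists psi1 psi2 : R -> C, forall x, D x ->
    is_derive_within D psi x (psi1 x) /\
    is_derive_within D psi1 x (psi2 x) /\
    (psi2 x + RtoC (k ^ 2 - 2 * U x)%R * psi x = 0)%C.

Definition continuously_differentiable (f : R -> C) : Prop :=
  exists f1 : R -> C, forall x,
    is_derive (V := C_R_NormedModule) f x (f1 x) /\
    continuous (U := C_R_NormedModule) f1 x.

(* [f] is of class C^2 in a neighbourhood of [x]. *)
Definition twice_continuously_differentiable_at (f : R -> C) (x : R) : Prop :=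
  exists f1 f2 : R -> C, locally x (fun y =>
    is_derive (V := C_R_NormedModule) f y (f1 y) /\
    is_derive (V := C_R_NormedModule) f1 y (f2 y) /\
    continuous (U := C_R_NormedModule) f2 y).

Definition analytic_at (f : R -> C) (x : R) : Prop :=
  exists a : nat -> C, locally x (fun y =>
    is_pseries (K := R_AbsRing) (V := C_R_NormedModule) a (y - x) (f y)).

Definition parabolic_barrier (alpha U0 x : R) : R :=
  if Rle_dec (Rabs x) alpha then U0 / alpha ^ 2 * (alpha ^ 2 - x ^ 2) else 0.

(* Main.v *)
Require Import Defs.
From Stdlib Require Import Reals List Lra Lia.
From Coquelicot Require Import Coquelicot.
Open Scope R_scope.

(** Away from the matching points the equation reads [psi'' = (2 U - k^2) psi],
    whose right-hand side is continuous everywhere.  Thus [psi'] is continuous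
    and its derivative extends continuously across each matching point, so by
    the mean value theorem [psi'] is differentiable there, with the limit value.

    For the parabolic barrier, [2 U - k^2] is a polynomial of degree at most two
    near every point other than [alpha] and [-alpha].  The recurrence for the
    Taylor coefficients then gives a convergent power series solution with the
    same initial data as [psi], and Gronwall's inequality identifies the two. *)

(** * Derivatives across an isolated point *)

(** The mean value theorem on the segment from [x] to [x + h] needs differentiability only in its
    open interior, so the difference quotient equals [g c] for some [c] in the segment, and [g c]
    tends to [g x] by continuity. *)
Lemma is_derive_removable (f g : R -> R) (x : R) :
  continuous f x -> continuous g x ->
  locally x (fun y => y <> x -> is_derive f y (g y)) ->
  is_derive f x (g x).
Proof.
intros Hf Hg [d Hd].
apply is_derive_Reals; intros eps Heps.
destruct (proj1 (filterlim_locally (F := locally x) g (g x)) Hg (mkposreal eps Heps))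
  as [d' Hd'].
assert (Hm : 0 < Rmin d d') by (apply Rmin_pos; apply cond_pos).
exists (mkposreal _ Hm); intros h Hh0 Hh; simpl in Hh.
assert (Hhd : Rabs h < d) by (eapply Rlt_le_trans; [exact Hh | apply Rmin_l]).
assert (Hhd' : Rabs h < d') by (eapply Rlt_le_trans; [exact Hh | apply Rmin_r]).
assert (Hin : forall y, Rmin x (x + h) <= y <= Rmax x (x + h) ->
                Rabs (y - x) <= Rabs h).
{ intros y; unfold Rmin, Rmax; destruct (Rle_dec x (x + h)); intros Hy;
    unfold Rabs; destruct (Rcase_abs h), (Rcase_abs (y - x)); lra. }
assert (Hder : forall y, Rmin x (x + h) <= y <= Rmax x (x + h) -> y <> x ->
                 is_derive f y (g y)).
{ intros y Hy Hyx; apply Hd; [ | exact Hyx].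
  change (Rabs (y - x) < d); specialize (Hin y Hy); lra. }
destruct (MVT_gen f x (x + h) g) as [c [Hc Hfc]].
- intros y Hy; apply Hder; [lra | ].
  intros ->; revert Hy; unfold Rmin, Rmax; destruct (Rle_dec x (x + h)); lra.
- intros y Hy; apply continuity_pt_filterlim.
  destruct (Req_dec y x) as [-> | Hyx]; [exact Hf | ].
  apply (ex_derive_continuous f y); exists (g y); now apply Hder.
- rewrite Hfc; replace (g c * (x + h - x) / h) with (g c) by (field; exact Hh0).
  apply (Hd' c); change (Rabs (c - x) < d'); specialize (Hin c Hc); lra.
Qed.

(** * Uniqueness for second-order linear equations *)

Lemma nondecreasing_of_derive_nonneg (f df : R -> R) (a b : R) :
  a <= b -> (forall y, a <= y <= b -> is_derive f y (df y) /\ 0 <= df y) ->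
  f a <= f b.
Proof.
intros Hab H.
destruct (MVT_gen f a b df) as [c [Hc Hfc]].
- intros y Hy; rewrite Rmin_left, Rmax_right in Hy by exact Hab; apply H; lra.
- intros y Hy; rewrite Rmin_left, Rmax_right in Hy by exact Hab.
  apply continuity_pt_filterlim, (ex_derive_continuous f y).
  exists (df y); apply H; lra.
- rewrite Rmin_left, Rmax_right in Hc by exact Hab.
  destruct (H c Hc) as [_ Hc0].
  assert (0 <= df c * (b - a)) by (apply Rmult_le_pos; lra); lra.
Qed.

Lemma linear_ode2_unique_zero (w w1 q : R -> R) (x d K : R) :
  (forall y, Rabs (y - x) < d -> is_derive w y (w1 y)) ->
  (forall y, Rabs (y - x) < d -> is_derive w1 y (q y * w y)) ->
  (forall y, Rabs (y - x) < d -> Rabs (q y) <= K) ->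
  w x = 0 -> w1 x = 0 ->
  forall y, Rabs (y - x) < d -> w y = 0.
Proof.
intros Hw Hw1 HK Hx Hx1 y Hy.
(* Gronwall for the energy E = w^2 + w'^2, which satisfies |E'| <= (1 + K) E. *)
set (E := fun z => w z ^ 2 + w1 z ^ 2).
set (dE := fun z => 2 * w z * w1 z * (1 + q z)).
(* The sign [s = 1] serves the points to the right of [x] and [s = -1] those to the left. In both
   cases the function differentiated here is nonincreasing, by the bound on [dE], and it vanishes at
   [x]. *)
assert (HE : forall s z, Rabs (z - x) < d ->
   is_derive (fun z => s * (E z * exp (- s * (1 + K) * z))) z
      (s * (dE z - s * (1 + K) * E z) * exp (- s * (1 + K) * z))).
{ intros s z Hz; unfold E, dE.
  pose proof (is_derive_unique _ _ _ (Hw z Hz)) as D1.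
  pose proof (is_derive_unique _ _ _ (Hw1 z Hz)) as D2.
  auto_derive.
  - repeat split; [now exists (w1 z); apply Hw | now exists (q z * w z); apply Hw1].
  - replace (Derive (fun x0 : R => w x0) z) with (w1 z) by (symmetry; exact D1).
    replace (Derive (fun x0 : R => w1 x0) z) with (q z * w z) by (symmetry; exact D2).
    ring. }
assert (HdE : forall z, Rabs (z - x) < d -> Rabs (dE z) <= (1 + K) * E z).
{ intros z Hz; unfold dE, E; rewrite Rabs_mult.
  assert (H1 : Rabs (2 * w z * w1 z) <= w z ^ 2 + w1 z ^ 2).
  { pose proof (pow2_ge_0 (w z + w1 z)); pose proof (pow2_ge_0 (w z - w1 z)).
    apply Rabs_le; split; lra. }
  assert (H2 : Rabs (1 + q z) <= 1 + K).
  { eapply Rle_trans; [apply Rabs_triang | ]; rewrite Rabs_R1.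
    specialize (HK z Hz); lra. }
  rewrite (Rmult_comm (1 + K)).
  apply Rmult_le_compat; auto using Rabs_pos. }
assert (HE0 : E y <= 0).
{ destruct (Rle_lt_dec x y) as [Hxy | Hxy].
  - assert (H : - (1 * (E x * exp (- 1 * (1 + K) * x)))
               <= - (1 * (E y * exp (- 1 * (1 + K) * y)))).
    { apply (nondecreasing_of_derive_nonneg
               (fun z => - (1 * (E z * exp (- 1 * (1 + K) * z))))
               (fun z => - (1 * (dE z - 1 * (1 + K) * E z) * exp (- 1 * (1 + K) * z))));
        [exact Hxy | ].
      intros z Hz.
      assert (Hzd : Rabs (z - x) < d).
      { rewrite Rabs_pos_eq in Hy |- * by lra; lra. }
      split.
      - apply (is_derive_opp (V := R_NormedModule)), HE, Hzd.
      - specialize (HdE z Hzd); apply Rabs_le_between in HdE.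
        pose proof (exp_pos (- 1 * (1 + K) * z)); nra. }
    replace (E x) with 0 in H by (unfold E; rewrite Hx, Hx1; ring).
    pose proof (exp_pos (- 1 * (1 + K) * y)); nra.
  - assert (H : - (-1 * (E y * exp (- -1 * (1 + K) * y)))
               <= - (-1 * (E x * exp (- -1 * (1 + K) * x)))).
    { apply (nondecreasing_of_derive_nonneg
               (fun z => - (-1 * (E z * exp (- -1 * (1 + K) * z))))
               (fun z => - (-1 * (dE z - -1 * (1 + K) * E z) * exp (- -1 * (1 + K) * z))));
        [lra | ].
      intros z Hz.
      assert (Hzd : Rabs (z - x) < d).
      { rewrite Rabs_left1 in Hy |- * by lra; lra. }
      split.
      - apply (is_derive_opp (V := R_NormedModule)), HE, Hzd.
      - specialize (HdE z Hzd); apply Rabs_le_between in HdE.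
        pose proof (exp_pos (- -1 * (1 + K) * z)); nra. }
    replace (E x) with 0 in H by (unfold E; rewrite Hx, Hx1; ring).
    pose proof (exp_pos (- -1 * (1 + K) * y)); nra. }
unfold E in HE0; nra.
Qed.

(** * Power series solutions when the coefficient is quadratic *)

(** Matching powers of z in w'' = (q0 + q1 z + q2 z^2) w determines a_(n+2) from a_n, a_(n-1),
    a_(n-2), with divisor (n+1)(n+2). The divisor is at least 1, so the coefficients grow at most
    geometrically and the radius of convergence is positive. *)
Lemma quadratic_ode_coefficients (q0 q1 q2 c0 c1 : R) :
  exists a : nat -> R,
    a 0%nat = c0 /\ a 1%nat = c1 /\
    (forall n, PS_derive (PS_derive a) n =
       PS_plus (PS_scal q0 a)
         (PS_plus (PS_scal q1 (PS_incr_1 a))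
                  (PS_scal q2 (PS_incr_1 (PS_incr_1 a)))) n) /\
    exists r, 0 < r /\ Rbar_le r (CV_radius a).
Proof.
(* The state at [n] carries the coefficients of index n, n+1, n-1, n-2. *)
set (st := fix st n : R * R * R * R :=
  match n with
  | O => (c0, c1, 0, 0)
  | S m => let '(a, b, c, d) := st m in
      (b, (q0 * a + q1 * c + q2 * d) / (INR (S m) * INR (S (S m))), a, c)
  end).
set (a := fun n => fst (fst (fst (st n)))).
(* [PS_incr_1] raises the index by one and puts zero at index 0, which is why the state starts with
   two zeros for the coefficients of index -1 and -2. *)
assert (Hst : forall n, st n =
   (a n, a (S n), PS_incr_1 a n, PS_incr_1 (PS_incr_1 a) n)).
{ assert (HS : forall m, fst (fst (fst (st (S m)))) = snd (fst (fst (st m)))).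
  { intros m; simpl; now destruct (st m) as [[[p q] r] s]. }
  intros n; induction n as [ | n IH]; [reflexivity | ].
  assert (E : st (S n) = (a (S n), snd (fst (fst (st (S n)))), a n, PS_incr_1 a n)).
  { simpl; rewrite IH; reflexivity. }
  rewrite E at 1; rewrite <- HS; destruct n; reflexivity. }
assert (Hrec : forall n, a (S (S n)) =
   (q0 * a n + q1 * PS_incr_1 a n + q2 * PS_incr_1 (PS_incr_1 a) n)
     / (INR (S n) * INR (S (S n)))).
{ intros n; pose proof (Hst (S n)) as H.
  change (st (S n)) with (let '(a, b, c, d) := st n in
      (b, (q0 * a + q1 * c + q2 * d) / (INR (S n) * INR (S (S n))), a, c)) in H.
  rewrite (Hst n) in H; congruence. }
assert (Hpos : forall n, 1 <= INR (S n) * INR (S (S n))).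
{ intros n; rewrite !S_INR; pose proof (pos_INR n); nra. }
exists a; split; [reflexivity | split; [reflexivity | split]].
- intros n; unfold PS_derive, PS_plus, PS_scal; rewrite Hrec.
  change scal with Rmult; change plus with Rplus.
  specialize (Hpos n); field; split; apply not_0_INR; lia.
- set (Q := Rabs q0 + Rabs q1 + Rabs q2).
  (* [A] covers the two initial coefficients. [Q <= M] pays for one step of the recurrence, and
     [1 <= M] makes [A * M ^ n] nondecreasing, so that the bound at [n] also covers the earlier
     coefficients. *)
  set (M := 1 + Q); set (A := Rabs c0 + Rabs c1).
  pose proof (Rabs_pos q0); pose proof (Rabs_pos q1); pose proof (Rabs_pos q2).
  pose proof (Rabs_pos c0); pose proof (Rabs_pos c1).
  assert (HM : 1 <= M) by (unfold M, Q; lra).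
  assert (HA : 0 <= A) by (unfold A; lra).
  assert (Hmono : forall n, A * M ^ n <= A * M ^ S n).
  { intros n; apply Rmult_le_compat_l; [exact HA | ].
    apply Rle_pow; [exact HM | lia]. }
  assert (Hnn : forall n, 0 <= A * M ^ n).
  { intros n; apply Rmult_le_pos; [exact HA | ]; apply pow_le; lra. }
  (* Two consecutive coefficients and both shifts are bounded together, so that plain induction
     carries a recurrence reaching several indices back. *)
  assert (Hb : forall n, Rabs (a n) <= A * M ^ n /\ Rabs (a (S n)) <= A * M ^ S n /\
      Rabs (PS_incr_1 a n) <= A * M ^ n /\
      Rabs (PS_incr_1 (PS_incr_1 a) n) <= A * M ^ n).
  { induction n as [ | n (IH0 & IH1 & IH2 & IH3)].
    - unfold PS_incr_1; simpl; change (zero : R) with 0; rewrite Rabs_R0.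
      change (a 0%nat) with c0; change (a 1%nat) with c1.
      unfold A in *; repeat split; nra.
    - assert (HaS : Rabs (a (S (S n))) <= A * M ^ S (S n)).
      { rewrite Hrec; unfold Rdiv; rewrite Rabs_mult.
        assert (Hi : Rabs (/ (INR (S n) * INR (S (S n)))) <= 1).
        { specialize (Hpos n); rewrite Rabs_pos_eq.
          - rewrite <- Rinv_1; apply Rinv_le_contravar; lra.
          - apply Rlt_le, Rinv_0_lt_compat; lra. }
        assert (Hs : Rabs (q0 * a n + q1 * PS_incr_1 a n +
                        q2 * PS_incr_1 (PS_incr_1 a) n) <= Q * (A * M ^ n)).
        { eapply Rle_trans; [apply Rabs_triang | ].
          eapply Rle_trans; [apply Rplus_le_compat_r, Rabs_triang | ].
          rewrite !Rabs_mult; unfold Q.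
          rewrite !Rmult_plus_distr_r.
          repeat apply Rplus_le_compat; apply Rmult_le_compat_l; assumption. }
        assert (Q * (A * M ^ n) <= A * M ^ S (S n)).
        { apply Rle_trans with (A * M ^ S n); [ | apply Hmono].
          simpl; unfold M at 2; specialize (Hnn n); nra. }
        pose proof (Rabs_pos (q0 * a n + q1 * PS_incr_1 a n +
                        q2 * PS_incr_1 (PS_incr_1 a) n)).
        nra. }
      repeat split; [exact IH1 | exact HaS | | ].
      + change (PS_incr_1 a (S n)) with (a n); specialize (Hmono n); lra.
      + change (PS_incr_1 (PS_incr_1 a) (S n)) with (PS_incr_1 a n);
          specialize (Hmono n); lra. }
  exists (/ M); split; [apply Rinv_0_lt_compat; lra | ].
  (* At the radius [/ M] the terms of the series stay bounded by [A]. *)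
  apply (proj1 (CV_radius_bounded a)); exists A; intros n.
  rewrite Rabs_mult, pow_inv, (Rabs_pos_eq (/ M ^ n)).
  + assert (HMn : 0 < M ^ n) by (apply pow_lt; lra).
    apply Rmult_le_reg_r with (M ^ n); [exact HMn | ].
    rewrite Rmult_assoc, Rinv_l, Rmult_1_r by lra; apply Hb.
  + apply Rlt_le, Rinv_0_lt_compat, pow_lt; lra.
Qed.

Lemma quadratic_ode_pseries (u u1 : R -> R) (q0 q1 q2 x : R) :
  locally x (fun y => is_derive u y (u1 y) /\
    is_derive u1 y ((q0 + q1 * (y - x) + q2 * (y - x) ^ 2) * u y)) ->
  exists a, locally x (fun y =>
    is_pseries (K := R_AbsRing) (V := R_NormedModule) a (y - x) (u y)).
Proof.
intros [d Hd].
destruct (quadratic_ode_coefficients q0 q1 q2 (u x) (u1 x))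
  as (a & Ha0 & Ha1 & Hrec & r & Hr & Hra).
exists a.
assert (Hm : 0 < Rmin d r) by (apply Rmin_pos; [apply cond_pos | exact Hr]).
set (m := Rmin d r) in *.
assert (Hmd : m <= d) by apply Rmin_l.
assert (Hmr : m <= r) by apply Rmin_r.
set (q := fun y => q0 + q1 * (y - x) + q2 * (y - x) ^ 2).
set (s := fun y => PSeries a (y - x)).
set (s1 := fun y => PSeries (PS_derive a) (y - x)).
assert (Hcv : forall y, Rabs (y - x) < m -> Rbar_lt (Rabs (y - x)) (CV_radius a)).
{ intros y Hy; eapply Rbar_lt_le_trans; [ | exact Hra]; simpl; lra. }
assert (Hs : forall y, Rabs (y - x) < m -> is_derive s y (s1 y)).
{ intros y Hy; unfold s, s1.
  evar_last.
  - apply (is_derive_comp (PSeries a) (fun y => y - x)).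
    + apply is_derive_PSeries, Hcv, Hy.
    + auto_derive; [trivial | reflexivity].
  - apply (scal_one (V := R_NormedModule)). }
assert (Hs1 : forall y, Rabs (y - x) < m -> is_derive s1 y (q y * s y)).
{ intros y Hy; unfold s, s1.
  evar_last.
  - apply (is_derive_comp (PSeries (PS_derive a)) (fun y => y - x)).
    + apply is_derive_PSeries; rewrite CV_radius_derive; apply Hcv, Hy.
    + auto_derive; [trivial | reflexivity].
  (* By [Hrec] the twice differentiated series is a combination of [a] and its shifts, and each
     shift amounts to a factor [y - x]. *)
  - rewrite (scal_one (V := R_NormedModule)), (PSeries_ext _ _ _ Hrec).
    assert (Hex : ex_pseries a (y - x)) by (apply CV_radius_inside, Hcv, Hy).
    assert (Hc : forall (c : R) (b : nat -> R), ex_pseries b (y - x) ->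
              ex_pseries (PS_scal c b) (y - x)).
    { intros c b Hb; apply ex_pseries_scal; [apply Rmult_comm | exact Hb]. }
    assert (Hex1 : ex_pseries (PS_incr_1 a) (y - x)) by apply ex_pseries_incr_1, Hex.
    assert (Hex2 : ex_pseries (PS_incr_1 (PS_incr_1 a)) (y - x))
      by apply ex_pseries_incr_1, Hex1.
    rewrite PSeries_plus;
      [ | apply Hc, Hex | apply ex_pseries_plus; apply Hc; assumption].
    rewrite PSeries_plus; [ | apply Hc; assumption ..].
    rewrite !PSeries_scal, !PSeries_incr_1.
    unfold q; ring. }
exists (mkposreal m Hm); intros y Hy; change (Rabs (y - x) < m) in Hy.
replace (u y) with (PSeries a (y - x)); [apply PSeries_correct, CV_radius_inside, Hcv, Hy | ].
apply Rminus_diag_uniq.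
(* The difference of the series and [u] solves the same linear equation with zero data at [x]. The
   constant bounds [q] term by term where [Rabs (y - x) < m]. *)
apply (linear_ode2_unique_zero (fun y => s y - u y) (fun y => s1 y - u1 y) q x m
         (Rabs q0 + Rabs q1 * m + Rabs q2 * m ^ 2)); [ | | | | | exact Hy].
- intros z Hz; apply (is_derive_minus (V := R_NormedModule)); [apply Hs, Hz | ].
  apply Hd; change (Rabs (z - x) < d); lra.
- intros z Hz; evar_last.
  + apply (is_derive_minus (V := R_NormedModule)); [apply Hs1, Hz | ].
    apply Hd; change (Rabs (z - x) < d); lra.
  + change minus with Rminus; unfold q; ring.
- intros z Hz; unfold q.
  eapply Rle_trans; [apply Rabs_triang | ].
  eapply Rle_trans; [apply Rplus_le_compat_r, Rabs_triang | ].
  rewrite !Rabs_mult, <- RPow_abs.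
  pose proof (Rabs_pos (z - x)).
  repeat apply Rplus_le_compat; [lra | | ]; apply Rmult_le_compat_l;
    try apply Rabs_pos; [lra | apply pow_incr; lra].
- unfold s; rewrite Rminus_diag, PSeries_0, Ha0; ring.
- unfold s1; rewrite Rminus_diag, PSeries_0; unfold PS_derive; rewrite Ha1; simpl; ring.
Qed.

(** * Complex-valued functions through their components *)

(** The projections are continuous; conversely, balls of the product uniform structure are products
    of balls. *)
Lemma filterlim_C (T : Type) (F : (T -> Prop) -> Prop) (FF : Filter F)
    (f : T -> C) (l : C) :
  filterlim f F (locally (T := C_R_NormedModule) l) <->
  filterlim (fun y => fst (f y)) F (locally (fst l)) /\
  filterlim (fun y => snd (f y)) F (locally (snd l)).
Proof.
destruct l as [l1 l2]; split.
- intros H; split; (eapply filterlim_comp; [exact H | ]).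
  + apply (continuous_fst (U := R_UniformSpace) (V := R_UniformSpace)).
  + apply (continuous_snd (U := R_UniformSpace) (V := R_UniformSpace)).
- intros [H1 H2] P [eps HP].
  pose proof (H1 _ (locally_ball l1 eps)) as B1.
  pose proof (H2 _ (locally_ball l2 eps)) as B2.
  unfold filtermap in *; generalize (filter_and _ _ B1 B2); apply filter_imp.
  intros y Hy; apply HP, Hy.
Qed.

Lemma continuous_C (f : R -> C) (x : R) :
  continuous (U := C_R_NormedModule) f x <->
  continuous (fun y => fst (f y)) x /\ continuous (fun y => snd (f y)) x.
Proof. apply (filterlim_C _ (locally x)); typeclasses eauto. Qed.

(** Forward, the projections are linear over the reals. Backward, [f] is rebuilt as its real
    components times the fixed vectors [(1, 0)] and [(0, 1)]. *)
Lemma is_derive_C (f : R -> C) (x : R) (l : C) :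
  is_derive (V := C_R_NormedModule) f x l <->
  is_derive (fun y => fst (f y)) x (fst l) /\
  is_derive (fun y => snd (f y)) x (snd l).
Proof.
split.
- intros H; split.
  + apply (filterdiff_comp' (V := C_R_NormedModule) (W := R_NormedModule)
             f (fun z => fst z) x (fun h => scal h l) (fun z => fst z) H).
    apply filterdiff_linear, (is_linear_fst (U := R_NormedModule) (V := R_NormedModule)).
  + apply (filterdiff_comp' (V := C_R_NormedModule) (W := R_NormedModule)
             f (fun z => snd z) x (fun h => scal h l) (fun z => snd z) H).
    apply filterdiff_linear, (is_linear_snd (U := R_NormedModule) (V := R_NormedModule)).
- intros [H1 H2].
  assert (E : forall z : C, plus (G := C_R_NormedModule)
      (scal (V := C_R_NormedModule) (fst z) (1, 0))
      (scal (V := C_R_NormedModule) (snd z) (0, 1)) = z).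
  { intros [z1 z2]; apply injective_projections; simpl;
      change plus with Rplus; change scal with Rmult; simpl; ring. }
  rewrite <- (E l).
  apply (is_derive_ext (V := C_R_NormedModule)
    (fun y => plus (scal (V := C_R_NormedModule) (fst (f y)) (1, 0))
                   (scal (V := C_R_NormedModule) (snd (f y)) (0, 1)))).
  { intros y; apply E. }
  apply (is_derive_plus (V := C_R_NormedModule));
    apply (is_derive_scal_l (V := C_R_NormedModule)); assumption.
Qed.

Lemma is_derive_C_unique (f : R -> C) (x : R) (l l' : C) :
  is_derive (V := C_R_NormedModule) f x l ->
  is_derive (V := C_R_NormedModule) f x l' -> l = l'.
Proof.
intros [H1 H2]%is_derive_C [H1' H2']%is_derive_C.
apply injective_projections.
- rewrite <- (is_derive_unique _ _ _ H1); apply is_derive_unique, H1'.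
- rewrite <- (is_derive_unique _ _ _ H2); apply is_derive_unique, H2'.
Qed.

(** * The Schrödinger equation at interior and matching points *)

(** When [D] is a neighbourhood of [x], restricting the neighbourhood filter of [x] to [D] does not
    change it. *)
Lemma is_derive_within_interior (D : R -> Prop) (f : R -> C) (x : R) (l : C) :
  locally x D -> is_derive_within D f x l ->
  is_derive (V := C_R_NormedModule) f x l.
Proof.
intros HD [Hl H]; split; [exact Hl | ].
intros y Hy eps.
assert (Hy' : is_filter_lim (within D (locally x)) y).
{ intros P HP; apply filter_le_within, Hy, HP. }
generalize (filter_and _ _ HD (H y Hy' eps)); apply filter_imp.
intros z [Hz Hz']; exact (Hz' Hz).
Qed.

(** Functions that agree near [x] have the same derivative near [x], so [f1] and [phi1] agree there.
    A second derivative known for a local formula thus becomes one for the global derivative [f1] of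
    [psi]. *)
Lemma second_derivative_transfer (psi phi f1 phi1 : R -> C) (x : R) (l : C) :
  (forall y, is_derive (V := C_R_NormedModule) psi y (f1 y)) ->
  locally x (fun y => psi y = phi y) ->
  locally x (fun y => is_derive (V := C_R_NormedModule) phi y (phi1 y)) ->
  is_derive (V := C_R_NormedModule) phi1 x l ->
  is_derive (V := C_R_NormedModule) f1 x l.
Proof.
intros Hpsi Heq Hphi.
apply (is_derive_ext_loc (V := C_R_NormedModule)).
generalize (filter_and _ _ (locally_locally _ _ Heq) Hphi); apply filter_imp.
intros y [Hy Hy1]; apply (is_derive_C_unique psi y); [ | apply Hpsi].
eapply (is_derive_ext_loc (V := C_R_NormedModule)); [ | exact Hy1].
revert Hy; apply filter_imp; intros z Hz; now symmetry.
Qed.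

(** Stated with a separate [phi] to serve two cases: a solution given only on the closed interval of
    the barrier, and [psi] itself off the matching points. *)
Lemma schrodinger_interior (k : R) (U : R -> R) (D : R -> Prop)
    (phi psi f1 : R -> C) (x : R) :
  solves_schrodinger_on k U D phi ->
  locally x D ->
  (forall y, D y -> psi y = phi y) ->
  (forall y, is_derive (V := C_R_NormedModule) psi y (f1 y)) ->
  is_derive (V := C_R_NormedModule) f1 x (RtoC (2 * U x - k ^ 2) * psi x)%C.
Proof.
intros (phi1 & phi2 & Hphi) HD Heq Hpsi.
apply (second_derivative_transfer psi phi f1 phi1); [exact Hpsi | | | ].
- revert HD; apply filter_imp, Heq.
- generalize (locally_locally _ _ HD); apply filter_imp; intros y Hy.
  apply (is_derive_within_interior D); [exact Hy | ].
  apply Hphi, (locally_singleton _ _ Hy).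
- assert (Hx : D x) by apply (locally_singleton _ _ HD).
  destruct (Hphi x Hx) as (_ & H2 & H3).
  apply (is_derive_within_interior D); [exact HD | ].
  rewrite (Heq x Hx); replace (RtoC (2 * U x - k ^ 2) * phi x)%C with (phi2 x);
    [exact H2 | ].
  replace (RtoC (2 * U x - k ^ 2)) with (- RtoC (k ^ 2 - 2 * U x))%C
    by (rewrite <- RtoC_opp; f_equal; ring).
  replace (phi2 x) with (phi2 x + RtoC (k ^ 2 - 2 * U x) * phi x
                         - RtoC (k ^ 2 - 2 * U x) * phi x)%C by ring.
  rewrite H3; ring.
Qed.

Lemma continuous_schrodinger_rhs (k : R) (U : R -> R) (psi : R -> C) (x : R) :
  continuous U x ->
  continuous (U := C_R_NormedModule) psi x ->
  continuous (U := C_R_NormedModule)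
    (fun y => RtoC (2 * U y - k ^ 2) * psi y)%C x.
Proof.
intros HU [H1 H2]%continuous_C.
assert (HQ : continuous (fun y => 2 * U y - k ^ 2) x).
{ apply (continuous_minus (V := R_NormedModule)); [ | apply continuous_const].
  apply (continuous_scal_r (V := R_NormedModule) 2 U), HU. }
apply continuous_C; split; simpl.
- apply (continuous_ext (fun y => (2 * U y - k ^ 2) * fst (psi y)));
    [intros y; simpl; ring | ].
  now apply (continuous_mult (K := R_AbsRing) (fun y => 2 * U y - k ^ 2) (fun y => fst (psi y))).
- apply (continuous_ext (fun y => (2 * U y - k ^ 2) * snd (psi y)));
    [intros y; simpl; ring | ].
  now apply (continuous_mult (K := R_AbsRing) (fun y => 2 * U y - k ^ 2) (fun y => snd (psi y))).
Qed.

Lemma twice_continuously_differentiable_at_matching_point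
    (k : R) (U : R -> R) (psi f1 : R -> C) (x : R) :
  (forall y, continuous U y) ->
  (forall y, is_derive (V := C_R_NormedModule) psi y (f1 y)) ->
  continuous (U := C_R_NormedModule) f1 x ->
  locally x (fun y => y <> x ->
    is_derive (V := C_R_NormedModule) f1 y (RtoC (2 * U y - k ^ 2) * psi y)%C) ->
  twice_continuously_differentiable_at psi x.
Proof.
intros HU Hpsi Hf1 Hf1'.
(* The equation itself supplies the candidate for the second derivative, by a formula that is
   continuous at [x] as well. *)
set (g := fun y => (RtoC (2 * U y - k ^ 2) * psi y)%C).
assert (Hg : forall y, continuous (U := C_R_NormedModule) g y).
{ intros y; apply continuous_schrodinger_rhs; [apply HU | ].
  apply (ex_derive_continuous (V := C_R_NormedModule)); exists (f1 y); apply Hpsi. }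
assert (Hx : is_derive (V := C_R_NormedModule) f1 x (g x)).
{ apply continuous_C in Hf1 as [Hf11 Hf12].
  destruct (proj1 (continuous_C _ _) (Hg x)) as [Hg1 Hg2].
  apply is_derive_C; split.
  - apply (is_derive_removable (fun y => fst (f1 y)) (fun y => fst (g y))); auto.
    revert Hf1'; apply filter_imp; intros y Hy Hyx; apply (is_derive_C f1 y), Hy, Hyx.
  - apply (is_derive_removable (fun y => snd (f1 y)) (fun y => snd (g y))); auto.
    revert Hf1'; apply filter_imp; intros y Hy Hyx; apply (is_derive_C f1 y), Hy, Hyx. }
exists f1, g; revert Hf1'; apply filter_imp; intros y Hy.
split; [apply Hpsi | split; [ | apply Hg]].
destruct (Req_dec y x) as [-> | Hyx]; [exact Hx | exact (Hy Hyx)].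
Qed.

(** A finite set has no accumulation point. The exception for [y = x] allows [x] to be a matching
    point itself. *)
Lemma locally_not_in_except (l : list R) (x : R) :
  locally x (fun y => y <> x -> ~ In y l).
Proof.
induction l as [ | z l IH]; [apply filter_forall; intros y _ [] | ].
assert (Hz : locally x (fun y => y <> x -> z <> y)).
{ destruct (Req_dec z x) as [-> | Hzx]; [apply filter_forall; intros y H ->; now apply H | ].
  generalize (open_neq z x (not_eq_sym Hzx)); apply filter_imp; intros y Hy _ ->; now apply Hy. }
generalize (filter_and _ _ Hz IH); apply filter_imp.
intros y [H1 H2] Hyx [H | H]; [now apply (H1 Hyx) | now apply (H2 Hyx)].
Qed.

Lemma locally_not_in (l : list R) (x : R) :
  ~ In x l -> locally x (fun y => ~ In y l).
Proof.
intros Hx; generalize (locally_not_in_except l x); apply filter_imp.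
intros y Hy; destruct (Req_dec y x) as [-> | Hyx]; auto.
Qed.

(** * Analyticity of complex-valued solutions *)

(** The powers of [x] are real scalars, so partial sums split into components. *)
Lemma is_pseries_C (a : nat -> C) (x : R) (l : C) :
  is_pseries (K := R_AbsRing) (V := R_NormedModule) (fun n => fst (a n)) x (fst l) ->
  is_pseries (K := R_AbsRing) (V := R_NormedModule) (fun n => snd (a n)) x (snd l) ->
  is_pseries (K := R_AbsRing) (V := C_R_NormedModule) a x l.
Proof.
intros H1 H2.
assert (E : forall n, sum_n (G := C_R_NormedModule)
      (fun k => scal (V := C_R_NormedModule) (pow_n (K := R_AbsRing) x k) (a k)) n =
    (sum_n (fun k => scal (V := R_NormedModule) (pow_n (K := R_AbsRing) x k) (fst (a k))) n,
     sum_n (fun k => scal (V := R_NormedModule) (pow_n (K := R_AbsRing) x k) (snd (a k))) n)).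
{ induction n as [ | n IH]; [rewrite !sum_O | rewrite !sum_Sn, IH]; reflexivity. }
unfold is_pseries, is_series.
apply filterlim_C; [typeclasses eauto | split].
- eapply filterlim_ext; [ | exact H1]; intros n; now rewrite E.
- eapply filterlim_ext; [ | exact H2]; intros n; now rewrite E.
Qed.

(** The coefficient of the equation is real, so real and imaginary parts solve it separately; their
    two real series combine into one with complex coefficients. *)
Lemma analytic_at_of_quadratic_ode (psi f1 : R -> C) (q0 q1 q2 x : R) :
  locally x (fun y => is_derive (V := C_R_NormedModule) psi y (f1 y) /\
    is_derive (V := C_R_NormedModule) f1 y
      (RtoC (q0 + q1 * (y - x) + q2 * (y - x) ^ 2) * psi y)%C) ->
  analytic_at psi x.
Proof.
intros H.
destruct (quadratic_ode_pseries (fun y => fst (psi y)) (fun y => fst (f1 y)) q0 q1 q2 x)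
  as [a1 Ha1].
{ revert H; apply filter_imp; intros y [[H1 _]%is_derive_C [H2 _]%is_derive_C].
  split; [exact H1 | evar_last; [exact H2 | simpl; ring]]. }
destruct (quadratic_ode_pseries (fun y => snd (psi y)) (fun y => snd (f1 y)) q0 q1 q2 x)
  as [a2 Ha2].
{ revert H; apply filter_imp; intros y [[_ H1]%is_derive_C [_ H2]%is_derive_C].
  split; [exact H1 | evar_last; [exact H2 | simpl; ring]]. }
exists (fun n => (a1 n, a2 n)).
generalize (filter_and _ _ Ha1 Ha2); apply filter_imp; intros y [H1 H2].
now apply is_pseries_C.
Qed.

(** * Plane waves and the parabolic barrier *)

Lemma plane_wave_cos_sin (k x : R) : plane_wave k x = (cos (k * x), sin (k * x)).
Proof.
unfold plane_wave, Cexp, Ci, RtoC, Re, Im.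
replace (fst ((0, 1) * (k, 0) * (x, 0))%C) with 0 by (simpl; ring).
replace (snd ((0, 1) * (k, 0) * (x, 0))%C) with (k * x) by (simpl; ring).
rewrite exp_0; apply injective_projections; simpl; ring.
Qed.

(** The derivative is written as a combination of the same two waves, so that the lemma applies
    again to give the second derivative. Both outer regions are instances: coefficients [1] and [r]
    on the left, [t] and [0] on the right. *)
Lemma is_derive_plane_waves (a b : C) (k x : R) :
  is_derive (V := C_R_NormedModule)
    (fun y => a * plane_wave k y + b * plane_wave (- k) y)%C x
    (Ci * RtoC k * a * plane_wave k x + - (Ci * RtoC k * b) * plane_wave (- k) x)%C.
Proof.
assert (E : forall c y, (cos (- c * y), sin (- c * y)) = (cos (c * y), - sin (c * y))).
{ intros c y; now rewrite Ropp_mult_distr_l_reverse, cos_neg, sin_neg. }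
apply is_derive_C; split.
- apply (is_derive_ext (fun y => fst a * cos (k * y) - snd a * sin (k * y) +
                          (fst b * cos (k * y) + snd b * sin (k * y)))).
  { intros y; rewrite !plane_wave_cos_sin, E; simpl; ring. }
  auto_derive; [trivial | ]; rewrite !plane_wave_cos_sin, E; simpl; ring.
- apply (is_derive_ext (fun y => fst a * sin (k * y) + snd a * cos (k * y) +
                          (- fst b * sin (k * y) + snd b * cos (k * y)))).
  { intros y; rewrite !plane_wave_cos_sin, E; simpl; ring. }
  auto_derive; [trivial | ]; rewrite !plane_wave_cos_sin, E; simpl; ring.
Qed.

Lemma schrodinger_free (k : R) (psi f1 : R -> C) (a b : C) (x : R) :
  (forall y, is_derive (V := C_R_NormedModule) psi y (f1 y)) ->
  locally x (fun y => psi y = (a * plane_wave k y + b * plane_wave (- k) y)%C) ->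
  is_derive (V := C_R_NormedModule) f1 x (RtoC (- k ^ 2) * psi x)%C.
Proof.
intros Hpsi Heq.
eapply (second_derivative_transfer psi _ f1 _ x _ Hpsi Heq).
- apply filter_forall; intros y; apply is_derive_plane_waves.
- replace (RtoC (- k ^ 2) * psi x)%C with
    (Ci * RtoC k * (Ci * RtoC k * a) * plane_wave k x +
     - (Ci * RtoC k * - (Ci * RtoC k * b)) * plane_wave (- k) x)%C.
  + apply is_derive_plane_waves.
  + rewrite (locally_singleton _ _ Heq).
    generalize (plane_wave k x), (plane_wave (- k) x); intros [p1 p2] [m1 m2].
    apply injective_projections; simpl; ring.
Qed.

(** The barrier is the positive part (p + |p|) / 2 of the parabola [p], which is nonnegative for |x|
    <= alpha and nonpositive beyond. *)
Lemma continuous_parabolic_barrier (alpha U0 x : R) :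
  0 < alpha -> 0 < U0 -> continuous (parabolic_barrier alpha U0) x.
Proof.
intros Ha HU.
set (p := fun y => U0 / alpha ^ 2 * (alpha ^ 2 - y ^ 2)).
assert (Hc : 0 < U0 / alpha ^ 2) by (apply Rdiv_lt_0_compat; [exact HU | now apply pow_lt]).
apply (continuous_ext (fun y => (p y + Rabs (p y)) * / 2)).
{ intros y; unfold parabolic_barrier; fold (p y).
  destruct (Rle_dec (Rabs y) alpha) as [Hy | Hy].
  - apply Rabs_le_between in Hy.
    assert (Hp0 : 0 <= p y) by (apply Rmult_le_pos; [lra | nra]).
    rewrite (Rabs_pos_eq _ Hp0); change ((p y + p y) * / 2 = p y); field.
  - assert (H : alpha < Rabs y) by lra.
    assert (alpha ^ 2 <= y ^ 2) by (rewrite <- (pow2_abs y); apply pow_incr; lra).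
    assert (Hp0 : p y <= 0) by (unfold p; nra).
    rewrite (Rabs_left1 _ Hp0); change ((p y + - p y) * / 2 = 0); field. }
assert (Hp : continuous p x) by (apply (ex_derive_continuous p); unfold p; auto_derive; trivial).
apply (continuous_mult (K := R_AbsRing) (fun y => p y + Rabs (p y)) (fun _ => / 2));
  [ | apply continuous_const].
apply (continuous_plus (V := R_NormedModule) p); [exact Hp | ].
apply (continuous_comp p Rabs); [exact Hp | apply continuous_Rabs].
Qed.

(** * Scattering by the barrier, then general continuous potentials *)

Theorem mainTheorem3 :
  forall k : R, 0 < k ->
  (forall (alpha U0 : R) (psi : R -> C) (r t : C),
     0 < alpha -> 0 < U0 ->
     continuously_differentiable psi ->
     (forall x, x <= - alpha ->
        psi x = (plane_wave k x + r * plane_wave (- k)%R x)%C) ->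
     (exists phi : R -> C,
        solves_schrodinger_on k (parabolic_barrier alpha U0)
          (fun x => - alpha <= x <= alpha) phi /\
        forall x, - alpha <= x <= alpha -> psi x = phi x) ->
     (forall x, alpha <= x -> psi x = (t * plane_wave k x)%C) ->
     twice_continuously_differentiable_at psi (- alpha) /\
     twice_continuously_differentiable_at psi alpha /\
     (forall x, x <> - alpha -> x <> alpha -> analytic_at psi x)) /\
  (forall (U : R -> R) (psi : R -> C) (matching_points : list R),
     (forall x, continuous U x) ->
     continuously_differentiable psi ->
     solves_schrodinger_on k U (fun x => ~ In x matching_points) psi ->
     forall x, In x matching_points ->
       twice_continuously_differentiable_at psi x).
Proof.
intros k _; split.
- intros alpha U0 psi r t Ha HU0 [f1 Hf1] Hleft (phi & Hphi & Hmid) Hright.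
  assert (Hpsi : forall y, is_derive (V := C_R_NormedModule) psi y (f1 y)) by apply Hf1.
  assert (Hlt : forall x, x < - alpha ->
     is_derive (V := C_R_NormedModule) f1 x (RtoC (- k ^ 2) * psi x)%C).
  { intros x Hx; apply (schrodinger_free k psi f1 1 r x Hpsi).
    generalize (open_lt (- alpha) x Hx); apply filter_imp; intros y Hy.
    rewrite Hleft by lra; ring. }
  assert (Hgt : forall x, alpha < x ->
     is_derive (V := C_R_NormedModule) f1 x (RtoC (- k ^ 2) * psi x)%C).
  { intros x Hx; apply (schrodinger_free k psi f1 t 0 x Hpsi).
    generalize (open_gt alpha x Hx); apply filter_imp; intros y Hy.
    rewrite Hright by lra; ring. }
  assert (Hin_loc : forall x, - alpha < x < alpha ->
     locally x (fun y => - alpha < y < alpha)).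
  { intros x Hx; apply (open_and _ _ (open_gt (- alpha)) (open_lt alpha)); exact Hx. }
  assert (Hin : forall x, - alpha < x < alpha ->
     is_derive (V := C_R_NormedModule) f1 x
       (RtoC (2 * parabolic_barrier alpha U0 x - k ^ 2) * psi x)%C).
  { intros x Hx.
    apply (schrodinger_interior k _ (fun y => - alpha <= y <= alpha) phi);
      [exact Hphi | | exact Hmid | exact Hpsi].
    (* Only the open interval is used, since at its endpoints [phi] has merely one-sided
       derivatives. *)
    generalize (Hin_loc x Hx); apply filter_imp; intros y Hy; lra. }
  assert (Hall : forall x, x <> - alpha -> x <> alpha ->
     is_derive (V := C_R_NormedModule) f1 x
       (RtoC (2 * parabolic_barrier alpha U0 x - k ^ 2) * psi x)%C).
  { intros x Hx1 Hx2.
    assert (Hout : alpha < Rabs x -> 2 * parabolic_barrier alpha U0 x - k ^ 2 = - k ^ 2).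
    { intros H; unfold parabolic_barrier; destruct (Rle_dec (Rabs x) alpha); lra. }
    destruct (Rlt_or_le x (- alpha)) as [H | H].
    { rewrite Hout by (rewrite Rabs_left; lra); now apply Hlt. }
    destruct (Rlt_or_le alpha x) as [H' | H'].
    { rewrite Hout by (rewrite Rabs_pos_eq; lra); now apply Hgt. }
    apply Hin; lra. }
  assert (HC2 : forall x, locally x (fun y => y <> x -> ~ In y (- alpha :: alpha :: nil)) ->
     twice_continuously_differentiable_at psi x).
  { intros x Hx.
    apply (twice_continuously_differentiable_at_matching_point k
             (parabolic_barrier alpha U0) psi f1 x).
    - intros y; now apply continuous_parabolic_barrier.
    - exact Hpsi.
    - apply Hf1.
    - revert Hx; apply filter_imp; intros y Hy Hyx; specialize (Hy Hyx); simpl in Hy.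
      apply Hall; intros ->; apply Hy; auto. }
  split; [ | split]; [apply HC2, locally_not_in_except .. | ].
  intros x Hx1 Hx2.
  destruct (Rlt_or_le x (- alpha)) as [H | H].
  (* Outside the barrier the coefficient of the equation is constant, so its linear and quadratic
     Taylor terms vanish. *)
  { apply (analytic_at_of_quadratic_ode psi f1 (- k ^ 2) 0 0 x).
    generalize (open_lt (- alpha) x H); apply filter_imp; intros y Hy.
    split; [apply Hpsi | ].
    replace (- k ^ 2 + 0 * (y - x) + 0 * (y - x) ^ 2) with (- k ^ 2) by ring; now apply Hlt. }
  destruct (Rlt_or_le alpha x) as [H' | H'].
  { apply (analytic_at_of_quadratic_ode psi f1 (- k ^ 2) 0 0 x).
    generalize (open_gt alpha x H'); apply filter_imp; intros y Hy.
    split; [apply Hpsi | ].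
    replace (- k ^ 2 + 0 * (y - x) + 0 * (y - x) ^ 2) with (- k ^ 2) by ring; now apply Hgt. }
  set (c := U0 / alpha ^ 2).
  (* Taylor coefficients at [x] of [2 c (alpha^2 - y^2) - k^2]. *)
  apply (analytic_at_of_quadratic_ode psi f1
           (2 * c * (alpha ^ 2 - x ^ 2) - k ^ 2) (- 4 * c * x) (- 2 * c) x).
  assert (Hx : - alpha < x < alpha) by lra.
  generalize (Hin_loc x Hx); apply filter_imp; intros y Hy.
  split; [apply Hpsi | ].
  replace (2 * c * (alpha ^ 2 - x ^ 2) - k ^ 2 + - 4 * c * x * (y - x)
           + - 2 * c * (y - x) ^ 2)
    with (2 * parabolic_barrier alpha U0 y - k ^ 2); [now apply Hin | ].
  unfold parabolic_barrier; fold c.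
  destruct (Rle_dec (Rabs y) alpha) as [_ | Hn]; [ring | ].
  exfalso; apply Hn, Rabs_le; lra.
- intros U psi l HU [f1 Hf1] Hsol x Hx.
  assert (Hpsi : forall y, is_derive (V := C_R_NormedModule) psi y (f1 y)) by apply Hf1.
  apply (twice_continuously_differentiable_at_matching_point k U psi f1 x);
    [exact HU | exact Hpsi | apply Hf1 | ].
  (* Near [x], every other point lies in the complement of the finite list, which is open, so the
     derivatives taken within it are ordinary ones. *)
  generalize (locally_not_in_except l x); apply filter_imp; intros y Hy Hyx.
  apply (schrodinger_interior k U (fun z => ~ In z l) psi);
    [exact Hsol | apply locally_not_in, Hy, Hyx | reflexivity | exact Hpsi].
Qed.
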